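(* There exist absolute constants $C,c>0$ such that the following holds. Let $k\ge1$, $0<\varepsilon<1$, let $\Gamma\subseteq\mathbb{F}_2^k$ be a generating set with positive weights $(w_\gamma)_{\gamma\in\Gamma}$, and let $G$ be the weighted Cayley graph on $\mathbb{F}_2^k$ generated by $(\Gamma, w)$. Then there exist a subset $\hat\Gamma\subseteq\Gamma$ with $|\hat\Gamma| \le C\frac{k}{\varepsilon^2}(\log_2(4k/\varepsilon))^{c}$ and positive weights $(\hat w_\gamma)_{\gamma\in\hat\Gamma}$ such that the weighted Cayley graph $\hat G$ on $\mathbb{F}_2^k$ generated by $(\hat\Gamma,\hat w)$ satisfies $$(1-\varepsilon)L_G \preceq L_{\hat G} \preceq (1+\varepsilon)L_G.$$
   Context: The weighted Cayley graph on $\mathbb{F}_2^k$ generated by $(\Gamma,w)$ has vertex set $\mathbb{F}_2^k$ and, for each $\gamma\in\Gamma$ and each vertex $x$, an edge between $x$ and $x+\gamma$ of weight $w_\gamma$; its adjacency matrix is $A_{x,y}=\sum_{\gamma\in\Gamma: x+\gamma=y} w_\gamma$. The Laplacian is $L = D - A$ where $D$ is the diagonal matrix of weighted degrees. $X\preceq Y$ means $Y-X$ is positive semidefinite. *)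

(* Defs.v *)
From HB Require Import structures.
From mathcomp Require Import all_boot all_order all_algebra.
From Stdlib Require Import Reals.
From mathcomp Require Import Rstruct.
Set Implicit Arguments. Unset Strict Implicit. Unset Printing Implicit Defensive.
Import Order.TTheory GRing.Theory Num.Theory.
Local Open Scope ring_scope.

Definition F2vec (k : nat) := 'rV['F_2]_k.

(* Gamma generates F_2^k (as a group): every element is a sum of elements of Gamma.
   (In F_2^k sums with repetitions reduce to sums over subsets.) *)
Definition generates (k : nat) (Gamma : {set F2vec k}) : Prop :=
  forall x : F2vec k, exists S : {set F2vec k},
    S \subset Gamma /\ x = \sum_(g in S) g.

Definition cay_adj (k : nat) (Gamma : {set F2vec k}) (w : F2vec k -> R)
  (x y : F2vec k) : R :=
  \sum_(g in Gamma | x + g == y) w g.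

Definition cay_deg (k : nat) (Gamma : {set F2vec k}) (w : F2vec k -> R)
  (x : F2vec k) : R :=
  \sum_(y : F2vec k) cay_adj Gamma w x y.

Definition cay_lap (k : nat) (Gamma : {set F2vec k}) (w : F2vec k -> R)
  (x y : F2vec k) : R :=
  (if x == y then cay_deg Gamma w x else 0) - cay_adj Gamma w x y.

Definition loewner_le (k : nat) (X Y : F2vec k -> F2vec k -> R) : Prop :=
  forall f : F2vec k -> R,
    0 <= \sum_(x : F2vec k) \sum_(y : F2vec k) f x * (Y x y - X x y) * f y.

Definition scale_mx (k : nat) (a : R) (X : F2vec k -> F2vec k -> R) :=
  fun x y => a * X x y.

Definition log2 (x : R) : R := (ln x / ln 2)%R.

(* Main.v *)
(** The Laplacian of a Cayley graph on F_2^k is diagonalised by the characters: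
    its eigenvalue at [a] is twice the weight of the codeword
    [(a . g)_(g in Gamma)], so one has to sparsify a weighted linear code.

    Among all probability distributions on the bases contained in [Gamma], take
    the one whose marginals [l g = P (g in B)] minimise [sum_g l(g)^2 / w(g)].
    First-order optimality says that every basis in its support has least total
    cost for [c g = l g / w g]; by exchange, a codeword restricted to
    [T = {c <= theta}] is then determined by its restriction to [B :&: T].
    Two consequences:
    - [w g = l g / c g] is a positive combination over [theta] of the weights
      [l] restricted to the sets [T], so it suffices to approximate each
      restriction;
    - [l (U) = E |U :&: B|], so Jensen gives
      [sum_U exp (- beta l (U)) <= (1 + exp (- beta))^k], the sum being over all
      supports [U] of codewords restricted to [T].  This replaces the usual
      counting of low-weight codewords.

    Since [l] has total mass [k], half of the [n] generators satisfy
    [l g <= 2 k / n].  Random signs on these and a union bound show that doubling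
    the weight of the [+] generators and dropping the [-] ones changes every
    codeword weight by a relative error [O (sqrt (k log n / n))] only, while
    removing a quarter of the generators.  Iterating, the errors form a
    geometric sum dominated by its last term. *)

From Stdlib Require Import Reals.
From mathcomp Require Import Rstruct Rstruct_topology.
From mathcomp Require Import boolp classical_sets reals topology normedtype sequences derive exp.
From mathcomp Require Import ring lra zify.
From HB Require Import structures.
From mathcomp Require Import all_boot all_order all_algebra.
Require Import Defs.
Set Implicit Arguments.
Unset Strict Implicit.
Unset Printing Implicit Defensive.
Import Order.TTheory GRing.Theory Num.Theory numFieldNormedType.Exports.
Local Open Scope ring_scope.

(** * Bases of F_2^k *)

Definition dotb k (a x : F2vec k) : bool := (a *m x^T) 0 0 != 0.

Lemma F2_cases (x : 'F_2) : x = 0 \/ x = 1.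
Proof.
case: x => -[|[|m]] // lt_m; [left|right]; exact: val_inj.
Qed.

Lemma dotbB k (a b x : F2vec k) : dotb (a - b) x = dotb a x (+) dotb b x.
Proof.
rewrite /dotb mulmxBl !mxE.
by case: (F2_cases (\sum_j a 0 j * x^T j 0)) => ->;
   case: (F2_cases (\sum_j b 0 j * x^T j 0)) => ->.
Qed.

Lemma dotb0 k (x : F2vec k) : dotb 0 x = false.
Proof. by rewrite -(subrr x) dotbB addbb. Qed.

Lemma dotbC k (a x : F2vec k) : dotb a x = dotb x a.
Proof. by rewrite /dotb -[a *m _]trmxK trmx_mul trmxK mxE. Qed.

Lemma dotbD k (a b x : F2vec k) : dotb (a + b) x = dotb a x (+) dotb b x.
Proof.
have -> : a + b = a - (0 - b) by rewrite sub0r opprK.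
by rewrite !dotbB dotb0.
Qed.

Lemma dotb_sum k (I : finType) (P : pred I) (F : I -> F2vec k) x :
  dotb (\sum_(i | P i) F i) x = \big[addb/false]_(i | P i) dotb (F i) x.
Proof. by apply: (big_morph (fun a => dotb a x)) => [a b|]; rewrite ?dotbD ?dotb0. Qed.

Lemma dotb_nondeg k (x : F2vec k) : x != 0 -> exists a, dotb a x.
Proof.
case/rV0Pn=> i xi; exists (delta_mx 0 i).
by rewrite /dotb -rowE !mxE.
Qed.

Lemma addvv k (x : F2vec k) : x + x = 0.
Proof.
apply/rowP => i; rewrite !mxE.
by case: (F2_cases (x 0 i)) => ->; rewrite ?addr0 //; exact: val_inj.
Qed.

Lemma card_F2vec k : #|{: F2vec k}| = (2 ^ k)%N.
Proof. by rewrite card_mx card_Fp // mul1n. Qed.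

Definition supp k (B : {set F2vec k}) (a : F2vec k) : {set F2vec k} :=
  [set g in B | dotb a g].

(** Dual form of spanning: only the zero linear form vanishes on [B]. *)
Definition separating k (B : {set F2vec k}) : bool :=
  [forall a, (supp B a == set0) ==> (a == 0)].

Lemma supp_sub k (B : {set F2vec k}) a : supp B a \subset B.
Proof. by apply/subsetP => x; rewrite inE => /andP[]. Qed.

Lemma suppI k (B T : {set F2vec k}) a : supp (B :&: T) a = B :&: supp T a.
Proof. by apply/setP => x; rewrite !inE andbA. Qed.

Lemma supp_eq0 k (B : {set F2vec k}) a :
  reflect {in B, forall b, ~~ dotb a b} (supp B a == set0).
Proof.
apply: (iffP eqP) => [E b bB|H].
  by apply/negP => ab; move/setP/(_ b): E; rewrite !inE bB ab.
by apply/setP => b; rewrite !inE; apply/negP => /andP[/H/negPf->].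
Qed.

Lemma suppB_eq0 k (B : {set F2vec k}) a a' :
  (supp B (a - a') == set0) = (supp B a == supp B a').
Proof.
apply/supp_eq0/eqP => [H|E b bB].
  apply/setP => b; rewrite !inE; case: (boolP (b \in B)) => //= /H.
  by rewrite dotbB; case: (dotb a b); case: (dotb a' b).
move/setP/(_ b): E; rewrite !inE bB dotbB /= => ->; by rewrite addbb.
Qed.

Lemma supp_inj k (B : {set F2vec k}) : separating B -> injective (supp B).
Proof.
move=> /forallP sB a a' /eqP; rewrite -suppB_eq0 => /(implyP (sB _)).
by rewrite subr_eq0 => /eqP.
Qed.

Definition is_basis k (G B : {set F2vec k}) : bool :=
  [&& B \subset G, #|B| == k & separating B].

(** A separating subset of least size has a dual family, so [supp B] is a bijection from F_2^k onto
    the subsets of [B]; comparing cardinalities gives [#|B| = k]. *)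
Lemma exists_basis k (G : {set F2vec k}) :
  separating G -> exists B, is_basis G B.
Proof.
move=> sG.
pose P (B : {set F2vec k}) := (B \subset G) && separating B.
have PG : P G by rewrite /P subxx.
case: (arg_minnP (fun B : {set F2vec k} => #|B|) PG) => B /andP[BG sB] minB.
have dual b : b \in B -> {a | supp B a == [set b]}.
  move=> bB; apply: sigW.
  have : ~~ separating (B :\ b).
    apply/negP => s'; have := minB (B :\ b).
    rewrite /P s' (subset_trans _ BG) ?subD1set // => /(_ isT).
    by rewrite (cardsD1 b B) bB ltnn.
  rewrite negb_forall => /existsP[a]; rewrite negb_imply => /andP[/supp_eq0 H a0].
  exists a; apply/eqP/setP => c; rewrite !inE.
  have [->|ncb] := eqVneq c b; last first.
    by case: (boolP (c \in B)) => //= cB; apply/negbTE/H; rewrite !inE ncb.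
  rewrite bB /=; case: (boolP (dotb a b)) => // ab; case/negP: a0.
  apply: (implyP (forallP sB a)); apply/supp_eq0 => d dB.
  by have [->//|ndb] := eqVneq d b; apply: H; rewrite !inE ndb.
exists B; rewrite /is_basis BG sB andbT /=.
pose e b := if boolP (b \in B) is AltTrue h then sval (dual b h) else 0.
have eP b : b \in B -> supp B (e b) = [set b].
  by move=> bB; rewrite /e; case: {-}_ / boolP => [h|/negP//]; case: (dual _ h) => ? /= /eqP.
have surj (V : {set F2vec k}) : V \subset B -> supp B (\sum_(b in V) e b) = V.
  move=> /subsetP VB; apply/setP => c; rewrite !inE dotb_sum.
  have E b : b \in V -> c \in B -> dotb (e b) c = (c == b).
    by move=> /VB /eP /setP /(_ c); rewrite !inE => + cB; rewrite cB.
  case: (boolP (c \in B)) => cB /=; last by apply/esym/negbTE; apply: contra cB => /VB.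
  rewrite (eq_bigr (fun b => c == b)) => [|b bV]; last exact: E.
  case: (boolP (c \in V)) => cV.
    rewrite (bigD1 c) //= eqxx big1 // => b /andP[_]; by rewrite eq_sym => /negbTE.
  by rewrite big1 // => b bV; apply/negbTE; apply: contraNneq cV => ->.
have le1 : (2 ^ k <= 2 ^ #|B|)%N.
  rewrite -(card_F2vec k) -card_powerset -cardsT -(card_imset setT (supp_inj sB)).
  by apply/subset_leq_card/subsetP => _ /imsetP[a _ ->]; rewrite inE supp_sub.
have le2 : (2 ^ #|B| <= 2 ^ k)%N.
  rewrite -(card_F2vec k) -card_powerset -cardsT.
  apply: leq_trans (leq_imset_card (supp B) _).
  apply/subset_leq_card/subsetP => V; rewrite inE => VB.
  by apply/imsetP; exists (\sum_(b in V) e b); rewrite ?surj ?inE.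
by rewrite !leq_exp2l // in le1 le2; rewrite eqn_leq le1 le2.
Qed.

Lemma supp_surj k (B V : {set F2vec k}) :
  #|B| = k -> separating B -> V \subset B -> exists a, supp B a = V.
Proof.
move=> cB sB VB.
have : supp B @: setT == powerset B.
  rewrite eqEcard (card_imset _ (supp_inj sB)) cardsT card_F2vec card_powerset cB leqnn.
  by rewrite andbT; apply/subsetP => _ /imsetP[a _ ->]; rewrite inE supp_sub.
by move/eqP/setP/(_ V); rewrite inE VB => /imsetP[a _ ->]; exists a.
Qed.

(** Expand [a] in the basis dual to [B]: since [dotb a g], some [b] in [supp B a] has a dual vector
    not vanishing at [g], and this [b] can be traded for [g]. It lies outside [T] because [a]
    vanishes on [B :&: T]. *)
Lemma basis_exchange k (G B T : {set F2vec k}) a g :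
  is_basis G B -> supp (B :&: T) a = set0 -> g \in G -> g \in T -> dotb a g ->
  exists b, [/\ b \in B, b \notin T, g \notin B & is_basis G (g |: B :\ b)].
Proof.
case/and3P => BG /eqP cB sB /eqP/supp_eq0 aBT gG gT ag.
have gB : g \notin B.
  by apply/negP => gB; move: ag; apply/negP/aBT; rewrite inE gB.
have dual b : {c | (b \in B) ==> (supp B c == [set b])}.
  apply: sigW; case: (boolP (b \in B)) => bB; last by exists 0.
  have /(supp_surj cB sB)[c cE] : [set b] \subset B by rewrite sub1set.
  by exists c; rewrite cE eqxx.
pose e b := sval (dual b).
have eP b : b \in B -> supp B (e b) = [set b].
  by rewrite /e; case: (dual b) => c /= /implyP H /H /eqP.
have aE : a = \sum_(b in supp B a) e b.
  apply: (supp_inj sB); apply/setP => c; rewrite !inE dotb_sum.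
  case: (boolP (c \in B)) => cBB //=.
  have E b : b \in supp B a -> dotb (e b) c = (c == b).
    by rewrite inE => /andP[/eP/setP/(_ c) + _]; rewrite !inE cBB.
  rewrite (eq_bigr (fun b => c == b)) => [|b bV]; last exact: E.
  case: (boolP (dotb a c)) => ac.
    rewrite (bigD1 c) /= ?inE ?cBB // eqxx big1 // => b /andP[_].
    by rewrite eq_sym => /negbTE.
  rewrite big1 // => b; rewrite inE => /andP[_ ab]; apply/negbTE.
  by apply: contraNneq ac => ->.
have /existsP[b /andP[]] : [exists b, (b \in supp B a) && dotb (e b) g].
  apply: contraT => /existsPn H; move: ag; rewrite aE dotb_sum big1 // => b bs.
  by have := H b; rewrite bs => /negbTE.
rewrite inE => /andP[bB ab] ebg; exists b; split=> //.
  by apply/negP => bT; move: ab; apply/negP/aBT; rewrite inE bB.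
apply/and3P; split.
- rewrite subUset sub1set gG /=; exact: subset_trans (subD1set _ _) BG.
- by rewrite cardsU1 !inE (negbTE gB) andbF /= -[X in _ == X]cB (cardsD1 b B) bB.
apply/forallP => c; apply/implyP => /supp_eq0 H.
have Hb d : d \in B -> d != b -> ~~ dotb c d by move=> dB ndb; apply: H; rewrite !inE dB ndb orbT.
case: (boolP (dotb c b)) => cb; last first.
  apply: (implyP (forallP sB c)); apply/supp_eq0 => d dB.
  by have [->//|ndb] := eqVneq d b; exact: Hb.
(* A form vanishing on [B :\ b] but not at [b] is the dual vector [e b], which does not vanish at
   [g]. *)
have ce : c = e b.
  apply: (supp_inj sB); rewrite eP //; apply/setP => d; rewrite !inE.
  have [->|ndb] := eqVneq d b; first by rewrite bB.
  by case: (boolP (d \in B)) => //= dB; apply/negbTE/Hb.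
by move: ebg; rewrite -ce; move/negP: (H g (setU11 _ _)).
Qed.

(** * Distributions of least energy *)

(** If [D] were negative, the linear term would dominate the quadratic one at the smaller of [s0]
    and [- D / (E + 1)]. *)
Lemma nonneg_slope (R : realFieldType) (s0 D E : R) : 0 < s0 -> 0 <= E ->
  (forall s, 0 < s -> s <= s0 -> 0 <= s * D *+ 2 + s ^+ 2 * E) -> 0 <= D.
Proof.
move=> s0_gt0 E_ge0 H; case: (leP 0 D) => // D_lt0.
have s1_gt0 : 0 < - D / (E + 1) by rewrite divr_gt0 ?oppr_gt0 //; lra.
pose s := Num.min s0 (- D / (E + 1)).
have s_gt0 : 0 < s by rewrite lt_min s0_gt0.
have := H s s_gt0; rewrite ge_min lexx => /(_ isT).
have : s * (E + 1) <= - D by rewrite -ler_pdivlMr ?ge_min ?lexx ?orbT //; lra.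
nra.
Qed.


Lemma continuous_sum (R : realType) (T : topologicalType) (I : finType) (F : I -> T -> R) :
  (forall i, continuous (F i)) -> continuous (fun x => \sum_i F i x).
Proof. by move=> cF; apply: continuous_big => //; exact: add_continuous. Qed.

Section Simplex.
Local Open Scope classical_set_scope.

Definition simplex (R : realType) n : set 'rV[R]_n :=
  [set r : 'rV[R]_n | (forall i, `[(0 : R), 1] (r ord0 i)) /\ \sum_i r ord0 i = 1].

Lemma simplexP (R : realType) n (r : 'rV[R]_n) :
  (forall i, 0 <= r ord0 i) -> \sum_i r ord0 i = 1 -> r \in @simplex R n.
Proof.
move=> r0 r1; rewrite in_setE; split=> // i; rewrite /= in_itv /= r0 -r1.
by rewrite (bigD1 i) //= lerDl sumr_ge0.
Qed.

Lemma compact_simplex (R : realType) n : compact (@simplex R n).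
Proof.
have -> : @simplex R n = [set r : 'rV[R]_n | forall i, `[0, 1] (r ord0 i)] `&`
    (fun r : 'rV[R]_n => \sum_i r ord0 i) @^-1` [set x | x = 1] by [].
apply: compact_closedI.
  by apply: (@rV_compact _ _ (fun=> `[(0:R), 1])) => i; exact: segment_compact.
apply: preimage_closed; last exact: closed_eq.
by move=> r _; apply: continuous_sum => i; exact: coord_continuous.
Qed.

Lemma simplex_argmin (R : realType) n (f : 'rV[R]_n.+1 -> R) : continuous f ->
  exists2 r, r \in @simplex R n.+1 & forall q, q \in @simplex R n.+1 -> f r <= f q.
Proof.
move=> cf; apply: compact_EVT_min (@compact_simplex R n.+1) _.
  exists (delta_mx 0 0); split => /= [i|].
    by rewrite mxE /= in_itv /=; case: eqP; rewrite /= ?lexx ?ler01.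
  by rewrite (bigD1 ord0) //= mxE !eqxx big1 ?addr0 // => i /negbTE i0; rewrite mxE i0.
exact: continuous_subspaceT.
Qed.
End Simplex.

(* First-order optimality at a minimiser of [sum_t c_t l(t)^2], where [l] is the
   barycentre of the points [v i]. *)
Lemma least_energy_mixture (R : realType) (I T : finType) (v : I -> T -> R) (c : T -> R) :
  inhabited I -> (forall t, 0 <= c t) ->
  exists p : I -> R, [/\ forall i, 0 <= p i, \sum_i p i = 1 &
    forall i j, 0 < p i ->
      \sum_t c t * (\sum_m p m * v m t) * v i t <=
      \sum_t c t * (\sum_m p m * v m t) * v j t].
Proof.
case=> i0 c_ge0.
have [n cardI] : {n | #|I| = n.+1}.
  by exists #|I|.-1; rewrite prednK //; apply/card_gt0P; exists i0.
have rk_bij : bijective (fun i : I => cast_ord cardI (enum_rank i)).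
  exists (fun i => enum_val (cast_ord (esym cardI) i)) => i.
    by rewrite cast_ordK enum_rankK.
  by rewrite enum_valK cast_ordKV.
move: rk_bij; move: (fun i => _) => rk rk_bij.
pose bar (r : 'rV[R]_n.+1) t := \sum_i r ord0 (rk i) * v i t.
have sumrk (r : 'rV[R]_n.+1) : \sum_i r ord0 (rk i) = \sum_i r ord0 i.
  by rewrite (reindex rk) //; exact: onW_bij.
pose f r := \sum_t c t * (bar r t * bar r t).
have cM (g h : 'rV[R]_n.+1 -> R) :
    continuous g -> continuous h -> continuous (fun q => g q * h q).
  by move=> cg ch q; apply: continuousM; [exact: cg|exact: ch].
have cbar t : continuous (bar^~ t).
  apply: continuous_sum => i; apply: cM; first exact: coord_continuous.
  by move=> q; exact: cst_continuous.
have [|r rS rmin] := @simplex_argmin R n f.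
  apply: continuous_sum => t; apply: (cM); last by apply: (cM); exact: cbar.
  by move=> q; exact: cst_continuous.
have [r0 r1] : (forall i, 0 <= r ord0 i) /\ \sum_i r ord0 i = 1.
  move: rS; rewrite in_setE => -[H r1]; split=> // i.
  by have := H i; rewrite /= in_itv /= => /andP[].
exists (fun i => r ord0 (rk i)); split=> [i||i j pi]; rewrite ?sumrk //.
rewrite -subr_ge0 -sumrB.
apply: (@nonneg_slope _ _ _ (\sum_t c t * (v j t - v i t) ^+ 2) pi).
  by apply: sumr_ge0 => t _; rewrite mulr_ge0 ?sqr_ge0.
move=> s s_gt0 s_le; have [->|nij] := eqVneq i j.
  rewrite !big1 ?mulr0 ?mul0rn ?addr0 // => t _; by rewrite subrr ?expr0n ?mulr0.
(* Move mass [s] from [i] to [j]; as [s] is at most the mass at [i], the point stays in the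
   simplex. *)
pose q := r + s *: (delta_mx 0 (rk j) - delta_mx 0 (rk i)).
have qE m : q ord0 (rk m) = r ord0 (rk m) + s * ((m == j)%:R - (m == i)%:R).
  by rewrite !mxE !eqxx /= !(inj_eq (bij_inj rk_bij)).
have barq t : bar q t = bar r t + s * (v j t - v i t).
  rewrite /bar; under eq_bigr do rewrite qE mulrDl -mulrA mulrBl.
  rewrite big_split /= -mulr_sumr sumrB; congr (_ + _ * (_ - _)).
    by rewrite (bigD1 j) //= eqxx mul1r big1 ?addr0 // => m /negbTE ->; rewrite mul0r.
  by rewrite (bigD1 i) //= eqxx mul1r big1 ?addr0 // => m /negbTE ->; rewrite mul0r.
have qS : q \in @simplex R n.+1.
  apply: simplexP => [m|].
    have [g _ gK] := rk_bij; rewrite -[m]gK qE.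
    have [->|nj] := eqVneq (g m) j.
      by rewrite eq_sym (negbTE nij) subr0 mulr1 addr_ge0 // ltW.
    have [->|ni] := eqVneq (g m) i; first by rewrite sub0r mulrN1 subr_ge0.
    by rewrite subrr mulr0 addr0.
  rewrite -sumrk; under eq_bigr do rewrite qE.
  rewrite big_split /= sumrk r1 -mulr_sumr sumrB.
  rewrite (bigD1 j) //= eqxx big1 => [|m /negbTE -> //].
  rewrite (bigD1 i) //= eqxx big1 => [|m /negbTE -> //].
  by rewrite !addr0 subrr mulr0 addr0.
have := rmin q qS; rewrite -subr_ge0 /f -sumrB.
rewrite mulr_sumr -sumrMnl mulr_sumr -big_split /=.
by congr (0 <= _); apply: eq_bigr => t _; rewrite barq -[\sum_m r ord0 (rk m) * v m t]/(bar r t); ring.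
Qed.

(** The exponential lies above its tangent line at the mean [m], and the average of that tangent
    line is [expR m]. *)
Lemma expR_jensen (R : realType) (I : finType) (p y : I -> R) :
  (forall i, 0 <= p i) -> \sum_i p i = 1 ->
  expR (\sum_i p i * y i) <= \sum_i p i * expR (y i).
Proof.
move=> p0 p1; set m := \sum_i _.
have -> : expR m = \sum_i p i * (expR m * (1 + (y i - m))).
  under eq_bigr do rewrite mulrCA mulrDr mulr1 mulrBr.
  by rewrite -mulr_sumr big_split sumrB /= p1 -mulr_suml p1 mul1r subrr addr0 mulr1.
apply: ler_sum => i _; rewrite ler_wpM2l //.
have -> : expR (y i) = expR m * expR (y i - m) by rewrite -expRD subrKC.
by rewrite ler_wpM2l ?expR_ge0 ?expR_ge1Dx.
Qed.

Lemma sum_powerset_exp (R : comNzRingType) (T : finType) (B : {set T}) (x : R) :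
  \sum_(V in powerset B) x ^+ #|V| = (1 + x) ^+ #|B|.
Proof.
rewrite -prodr_const [RHS]big_mkcond [LHS]big_mkcond /=.
rewrite [RHS](eq_bigr (fun i => (if i \in B then x else 0) + 1)); last first.
  by move=> i _; case: ifP => _; rewrite ?add0r // addrC.
rewrite bigA_distr; apply: eq_bigr => J _.
rewrite inE; case: (boolP (J \subset B)) => [/subsetP JB|/subsetPn[i iJ iB]].
  rewrite -prodr_const big_mkcond /=; apply: eq_bigr => i _.
  by case: (boolP (i \in J)) => // /JB ->.
by rewrite (bigD1 i) //= iJ (negbTE iB) mul0r.
Qed.

(* [U |-> U :&: B] is injective on the supports of codewords restricted to a
   cost threshold set, for every basis [B] of positive probability. *)
Lemma leverage_scores (R : realType) k (G : {set F2vec k}) (w : F2vec k -> R) :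
  separating G -> 0 \notin G -> {in G, forall g, 0 < w g} ->
  exists l : F2vec k -> R,
  [/\ {in G, forall g, 0 < l g}, \sum_(g in G) l g = k%:R &
    forall theta beta : R, 
    \sum_(U in supp [set g in G | l g / w g <= theta] @: setT)
       expR (- beta * \sum_(g in U) l g) <= (1 + expR (- beta)) ^+ k].
Proof.
move=> sG G0 w_gt0.
have [B0 basB0] := exists_basis sG.
pose I : finType := {B : {set F2vec k} | is_basis G B}.
pose v (B : I) g : R := (g \in sval B)%:R.
pose c g : R := if g \in G then (w g)^-1 else 0.
have c_ge0 g : 0 <= c g by rewrite /c; case: ifP => // /w_gt0/ltW; rewrite invr_ge0.
have [p [p_ge0 p_sum p_opt]] :=
  @least_energy_mixture R I _ v c (inhabits (exist _ B0 basB0)) c_ge0.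
pose l g := \sum_B p B * v B g.
have l_ge0 g : 0 <= l g by apply: sumr_ge0 => B _; rewrite mulr_ge0 // ler0n.
pose T theta := [set g in G | l g / w g <= theta].
have costE g : g \in G -> c g * l g = l g / w g by move=> gG; rewrite /c gG mulrC.
(* If [a] vanished on [B :&: T theta] but not at some [g] in [T theta], trading a basis element of
   cost above [theta] for [g] would lower the total cost, against [p_opt]. *)
have spanT (B : I) theta a : 0 < p B -> supp (sval B :&: T theta) a = set0 ->
    supp (T theta) a = set0.
  move=> pB aBT; apply/eqP/supp_eq0 => g gT; apply/negP => ag.
  have gG : g \in G by move: gT; rewrite inE => /andP[].
  have [b [bB bT gB basB']] := basis_exchange (svalP B) aBT gG gT ag.
  have bG : b \in G by case/and3P: (svalP B) => /subsetP /(_ b bB).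
  have := p_opt B (exist (is_basis G) _ basB') pB; rewrite leNgt => /negP; apply.
  rewrite -subr_lt0 -sumrB.
  rewrite (eq_bigr (fun t => c t * l t * ((t == g)%:R - (t == b)%:R))); last first.
    move=> t _; rewrite -mulrBr; congr (_ * _); rewrite /v /= !inE.
    have [->|ntg] := eqVneq t g; first by rewrite (negbTE gB); case: eqP gB bB => [->/negbTE->|].
    by have [->|ntb] := eqVneq t b; rewrite ?bB /= ?subrr ?sub0r ?subr0.
  under eq_bigr do rewrite mulrBr.
  rewrite sumrB (bigD1 g) //= big1 => [|t /negbTE ->]; last by rewrite mulr0.
  rewrite (bigD1 b) //= big1 => [|t /negbTE ->]; last by rewrite mulr0.
  rewrite !eqxx !mulr1 !addr0 !costE // subr_lt0.
  move: gT bT; rewrite !inE gG bG /= -ltNge; exact: le_lt_trans.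
exists l; split.
- move=> g gG; rewrite lt_neqAle l_ge0 andbT eq_sym; apply/negP => /eqP lg.
  have /dotb_nondeg[a] : g != 0 by apply: contraNneq G0 => <-.
  rewrite dotbC => ga.
  have [B pB] : exists B, 0 < p B.
    have /existsP[B pB] : [exists B, 0 < p B]; last by exists B.
    apply: contraT => /existsPn H; move: p_sum; rewrite big1 => [/eqP|B _].
      by rewrite eq_sym oner_eq0.
    by apply/eqP; rewrite eq_le p_ge0 andbT leNgt.
  (* The elements of [B] have positive marginals, so [B] misses [T 0]; by [spanT] every form then
     vanishes on [T 0], yet [g] lies there. *)
  have : supp (T 0) a != set0.
    by apply/set0Pn; exists g; rewrite !inE gG lg mul0r lexx dotbC.
  case/eqP; apply: (spanT B) => //; apply/eqP/supp_eq0 => b.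
  rewrite !inE => /andP[bB /andP[bG]]; rewrite pmulr_lle0 ?invr_gt0 ?w_gt0 // => lb.
  suff : 0 < l b by rewrite ltNge lb.
  rewrite /l (bigD1 B) //= ltr_wpDr ?sumr_ge0 // => [B' _|].
    by rewrite mulr_ge0 // ler0n.
  by rewrite /v bB mulr1.
- rewrite exchange_big /= -[RHS]mul1r -[X in X * _]p_sum mulr_suml; apply: eq_bigr => B _.
  rewrite -mulr_sumr; congr (_ * _).
  case/and3P: (svalP B) => BG /eqP cB _.
  have <- : #|sval B|%:R = k%:R :> R by rewrite cB.
  rewrite /v -sum1_card natr_sum [RHS]big_mkcond [LHS]big_mkcond /=.
  apply: eq_bigr => g _; case: ifP => [_|/negP gG]; first by case: ifP.
  by case: ifP => // gB; case: gG; apply: (subsetP BG).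
move=> theta beta; rewrite -/(T theta); set x := expR _.
have sumlE (U : {set F2vec k}) : \sum_(g in U) l g = \sum_B p B * #|U :&: sval B|%:R.
  rewrite exchange_big /=; apply: eq_bigr => B _; rewrite -mulr_sumr; congr (_ * _).
  rewrite -sum1_card natr_sum [RHS]big_mkcond [LHS]big_mkcond /=.
  by apply: eq_bigr => g _; rewrite inE /v; case: (g \in U); case: (g \in sval B).
apply: (@le_trans _ _ (\sum_(U in supp (T theta) @: setT)
    \sum_B p B * x ^+ #|U :&: sval B|)).
  apply: ler_sum => U _; rewrite sumlE mulr_sumr.
  under eq_bigr do rewrite mulrCA.
  apply: le_trans (expR_jensen _ p_ge0 p_sum) _.
  by apply: ler_sum => B _; rewrite ler_wpM2l // mulrC expRM_natl.
rewrite exchange_big /= -[leRHS]mul1r -[X in _ <= X * _]p_sum mulr_suml.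
apply: ler_sum => B _; rewrite -mulr_sumr.
have [pB|pB] := ltP 0 (p B); last first.
  by rewrite (_ : p B = 0) ?mul0r //; apply/eqP; rewrite eq_le pB p_ge0.
rewrite ler_wpM2l //.
case/and3P: (svalP B) => _ /eqP cB _.
have <- : (1 + x) ^+ #|sval B| = (1 + x) ^+ k by rewrite cB.
rewrite -sum_powerset_exp.
have inj : {in supp (T theta) @: setT &, injective (fun U => U :&: sval B)}.
  move=> _ _ /imsetP[a _ ->] /imsetP[a' _ ->] E; apply/eqP; rewrite -suppB_eq0.
  apply/eqP/(spanT B) => //; apply/eqP; rewrite suppB_eq0 !suppI.
  by rewrite setIC E setIC.
rewrite -(big_imset (fun V : {set F2vec k} => x ^+ #|V|) inj) /=.
rewrite [leRHS](bigID (mem ((fun U => U :&: sval B) @: (supp (T theta) @: setT)))) /=.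
rewrite ler_wpDr ?sumr_ge0 // => [V _|]; first by rewrite exprn_ge0 ?expR_ge0.
rewrite le_eqVlt; apply/orP; left; apply/eqP/eq_bigl => V.
rewrite andbC; case: (boolP (V \in _)) => //= /imsetP[U _ ->].
by rewrite inE subsetIr.
Qed.

(** * Concentration of signed sums *)

(** Combine [expR x * (1 - x) <= 1] with [(1 + x + 2 x^2) (1 - x) = 1 + x^2 (1 - 2 x) >= 1]. *)
Lemma expR_le_quadratic (R : realType) (x : R) :
  x <= 2^-1 -> expR x <= 1 + x + 2 * x ^+ 2.
Proof.
move=> x_le.
have e_ge : 1 - x <= expR (- x) by exact: expR_ge1Dx.
have : expR x * expR (- x) = 1 by rewrite expRxMexpNx_1.
have := expR_gt0 x; move: (expR x) (expR (- x)) e_ge => a b *.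
nra.
Qed.

Lemma expR_sym_le (R : realType) (x : R) :
  `|x| <= 2^-1 -> expR x + expR (- x) <= 2 * expR (2 * x ^+ 2).
Proof.
rewrite ler_norml => /andP[x_ge x_le].
have := expR_le_quadratic x_le.
have : expR (- x) <= 1 + - x + 2 * (- x) ^+ 2 by apply: expR_le_quadratic; lra.
have := expR_ge1Dx (2 * x ^+ 2); lra.
Qed.

(** Exponential moment of independent uniform signs, the expectation being a sum over all sign
    patterns: it factorises over coordinates. *)
Lemma sum_signs_expR (R : realType) (T : finType) (v : T -> R) :
  (forall i, `|v i| <= 2^-1) ->
  \sum_(s : {ffun T -> bool}) expR (\sum_i (-1) ^+ s i * v i) <=
  #|{ffun T -> bool}|%:R * expR (2 * \sum_i v i ^+ 2).
Proof.
move=> v_le.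
under eq_bigr do rewrite expR_sum.
rewrite -(bigA_distr_bigA (fun i (b : bool) => expR ((-1) ^+ b * v i))) /=.
rewrite card_ffun card_bool natrX mulr_sumr expR_sum -prodr_const -big_split /=.
apply: ler_prod => i _; rewrite big_bool /= expr1 expr0 mul1r mulN1r addrC.
by rewrite addr_ge0 ?expR_ge0 // expR_sym_le.
Qed.

(** Chernoff and union bound: a pattern violating some bound contributes at least 1 to the sum of
    the two-sided exponential moments, so if all patterns failed that sum would reach their
    number. *)
Lemma sign_choice (R : realType) (T J : finType) (P : pred J) (X : J -> T -> R) (b : J -> R) :
  (forall j i, P j -> `|X j i| <= 2^-1) ->
  \sum_(j | P j) 2 * expR (2 * \sum_i X j i ^+ 2 - b j) < 1 ->
  exists s : {ffun T -> bool},
    forall j, P j -> `|\sum_i (-1) ^+ s i * X j i| <= b j.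
Proof.
move=> X_le lt1; apply: contrapT => none.
have ge1 (s : {ffun T -> bool}) : 1 <= \sum_(j | P j)
    (expR (\sum_i (-1) ^+ s i * X j i - b j) +
     expR (\sum_i (-1) ^+ s i * - X j i - b j)).
  have [j Pj] : exists2 j, P j & b j < `|\sum_i (-1) ^+ s i * X j i|.
    apply: contrapT => H; apply: none; exists s => j Pj.
    by rewrite leNgt; apply/negP => lt_b; apply: H; exists j.
  move=> lt_b; rewrite (bigD1 j) //= ler_wpDr //.
    by apply: sumr_ge0 => i _; rewrite addr_ge0 ?expR_ge0.
  under [in X in _ + X]eq_bigr do rewrite mulrN.
  rewrite sumrN; move: lt_b; set y := \sum_i _ => lt_b.
  have := expR_ge0 (y - b j); have := expR_ge0 (- y - b j).
  case: (lerP 0 y) => y0; [move: lt_b; rewrite ger0_norm // | move: lt_b; rewrite ltr0_norm //].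
    by have := expR_ge1Dx (y - b j); lra.
  by have := expR_ge1Dx (- y - b j); lra.
have card_gt0 : (0 : R) < #|{ffun T -> bool}|%:R.
  by rewrite ltr0n; apply/card_gt0P; exists [ffun _ => false].
have : #|{ffun T -> bool}|%:R <= \sum_(s : {ffun T -> bool}) \sum_(j | P j)
    (expR (\sum_i (-1) ^+ s i * X j i - b j) +
     expR (\sum_i (-1) ^+ s i * - X j i - b j)).
  by rewrite -sum1_card natr_sum; apply: ler_sum => s _; exact: ge1.
rewrite exchange_big /= leNgt => /negP; apply.
rewrite -[ltRHS]mulr1.
apply: le_lt_trans (_ : _ <= #|{ffun T -> bool}|%:R *
   \sum_(j | P j) 2 * expR (2 * \sum_i X j i ^+ 2 - b j)) _; last first.
  by rewrite ltr_pM2l.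
rewrite mulr_sumr; apply: ler_sum => j Pj.
under eq_bigr do rewrite !expRD -mulrDl.
rewrite -mulr_suml big_split /= expRD !mulrA ler_wpM2r ?expR_ge0 //.
rewrite -mulrA mulrCA mulrDl mul1r lerD ?sum_signs_expR // => [i|]; first exact: X_le.
have -> : \sum_i X j i ^+ 2 = \sum_i (- X j i) ^+ 2.
  by apply: eq_bigr => i _; rewrite sqrrN.
by apply: (@sum_signs_expR _ _ (fun i => - X j i)) => i; rewrite normrN; exact: X_le.
Qed.

(* Abel summation over the superlevel sets of [g]. *)
Lemma layer_cake_ge0 (R : realFieldType) (I : finType) (A : {set I}) (g u : I -> R) :
  {in A, forall x, 0 <= g x} ->
  {in A, forall x, 0 <= \sum_(y in A | g x <= g y) u y} ->
  0 <= \sum_(x in A) g x * u x.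
Proof.
have [n] := ubnP #|A|; elim: n => // n IHn in A g *; rewrite ltnS => le_n g0 u0.
have [->|[x1 x1A]] := set_0Vmem A; first by rewrite big_set0.
case: (@arg_minP _ R I x1 (mem A) g x1A) => x0 x0A minx0.
(* Peel off the least value of [g]: it multiplies the full sum of [u], and the remainder lives on
   the strictly larger values. *)
have -> : \sum_(x in A) g x * u x =
    \sum_(x in A) (g x - g x0) * u x + g x0 * \sum_(x in A) u x.
  by rewrite mulr_sumr -big_split; apply: eq_bigr => x _ /=; ring.
rewrite addr_ge0 ?mulr_ge0 ?g0 //; last first.
  have := u0 x0 x0A; rewrite (eq_bigl (mem A)) // => y.
  rewrite -[mem A y]/(y \in A).
  by case: (boolP (y \in A)) => //= yA; exact: minx0.
pose A' := [set x in A | g x0 < g x].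
rewrite (bigID (fun x => g x0 < g x)) /= [X in _ + X]big1 => [|x /andP[xA]]; last first.
  rewrite -leNgt => le_x; suff -> : g x = g x0 by rewrite subrr mul0r.
  by apply/eqP; rewrite eq_le le_x minx0.
rewrite addr0 (eq_bigl (mem A')) => [|x]; last by rewrite !inE.
apply: IHn => [|x|x].
- apply: leq_trans le_n; apply/proper_card/properP.
  split; first by apply/subsetP => x; rewrite inE => /andP[].
  by exists x0; rewrite // inE ltxx andbF.
- by rewrite inE subr_ge0 => /andP[_ /ltW].
rewrite inE => /andP[xA x0x]; have := u0 x xA; congr (0 <= _); apply: eq_bigl => y.
rewrite !inE lerD2r; case: (y \in A) => //=.
by case: (boolP (g x <= g y)); rewrite ?andbF // andbT => /(lt_le_trans x0x) ->.
Qed.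

(** * Code sparsification *)

(* Half the Laplacian eigenvalue at the character [a]. *)
Definition cw (R : nmodType) k (w : F2vec k -> R) (G : {set F2vec k}) a : R :=
  \sum_(g in supp G a) w g.

(** Markov's inequality, used to count the generators with large [l]. *)
Lemma sumr_small_card (R : realFieldType) (I : finType) (A : {set I}) (l : I -> R) (t K : R) :
  {in A, forall i, t < l i} -> \sum_(i in A) l i <= K -> #|A|%:R * t <= K.
Proof.
move=> lt_l; apply: le_trans; rewrite mulr_natl -sumr_const; apply: ler_sum => i iA; exact/ltW/lt_l.
Qed.

Lemma pow1D_le (R : realType) (k : nat) (x : R) :
  0 <= x -> k%:R * x <= 2^-1 -> (1 + x) ^+ k - 1 <= 2 * (k%:R * x).
Proof.
move=> x0 kx; have kx0 : 0 <= k%:R * x by rewrite mulr_ge0 ?ler0n.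
have : (1 + x) ^+ k <= expR (k%:R * x).
  by rewrite expRM_natl lerXn2r ?nnegrE ?expR_ge0 ?expR_ge1Dx // addr_ge0.
have := expR_le_quadratic kx; nra.
Qed.

(** With [n = #|G|], [d^2 n / (16 k)] is the rate in the tail bound for a support, and [8 n^2] pays
    for the union over at most [n] thresholds and the supports at each. *)
Lemma sparsify_step (R : realType) k (G : {set F2vec k}) (w : F2vec k -> R) (d : R) :
  (0 < k)%N -> separating G -> 0 \notin G -> {in G, forall g, 0 < w g} ->
  0 < d <= 1 -> 
  expR (- (d ^+ 2 * #|G|%:R / (16 * k%:R))) <= (8 * #|G|%:R ^+ 2)^-1 ->
  exists (G' : {set F2vec k}) (w' : F2vec k -> R),
  [/\ G' \subset G, {in G', forall g, 0 < w' g}, (4 * #|G'| <= 3 * #|G|)%N &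
      forall a, `|cw w' G' a - cw w G a| <= d * cw w G a].
Proof.
move=> k_gt0 sG G0 w_gt0 /andP[d_gt0 d_le1] hexp.
have [l [l_gt0 l_sum l_exp]] := leverage_scores sG G0 w_gt0.
set n := #|G| in hexp *.
have le_kn : (k <= n)%N.
  by have [B /and3P[BG /eqP cB _]] := exists_basis sG; rewrite -[X in (X <= _)%N]cB subset_leq_card.
have k0 : 0 < k%:R :> R by rewrite ltr0n.
have n0 : 0 < n%:R :> R by rewrite ltr0n (leq_trans k_gt0).
have kn : k%:R <= n%:R :> R by rewrite ler_nat.
have n1 : 1 <= n%:R :> R by rewrite ler1n (leq_trans k_gt0).
(* Twice the average of [l], so at most half of [G] exceeds it. *)
pose tau : R := 2 * k%:R / n%:R.
have tau_gt0 : 0 < tau by rewrite divr_gt0 ?mulr_gt0.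
pose S := [set g in G | l g <= tau].
have SG : S \subset G by apply/subsetP => g; rewrite inE => /andP[].
pose beta := d ^+ 2 * n%:R / (16 * k%:R).
have betaE : beta = d ^+ 2 / (8 * tau) by rewrite /beta /tau; field; rewrite !gt_eqF.
(* The exponential moment bound [2 t^2 tau - t d] is minimal at this [t]. *)
pose t := d / (4 * tau).
have t_gt0 : 0 < t by apply: divr_gt0 => //; exact: mulr_gt0.
(* Only costs attained on [G] serve as thresholds, which leaves at most [n] sets for the union
   bound. *)
pose T h := [set g in G | l g / w g <= l h / w h].
pose L (U : {set F2vec k}) := \sum_(g in U) l g.
have lG (U : {set F2vec k}) g : U \subset G -> g \in U -> 0 < l g by move=> UG gU; apply/l_gt0/(subsetP UG).
pose P (j : F2vec k * {set F2vec k}) :=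
  (j.1 \in G) && ((j.2 \in supp (T j.1) @: setT) && (j.2 != set0)).
pose X (j : F2vec k * {set F2vec k}) g := if g \in j.2 :&: S then t * l g else 0.
have PG j : P j -> j.2 \subset G.
  case/and3P=> _ /imsetP[a _ ->] _; apply: subset_trans (supp_sub _ _) _.
  by apply/subsetP => g; rewrite inE => /andP[].
have X_le j g : P j -> `|X j g| <= 2^-1.
  move=> _; rewrite /X; case: ifP => [|_]; last by rewrite normr0 invr_ge0.
  rewrite !inE => /and3P[_ gG lg]; rewrite gtr0_norm; last by apply: mulr_gt0 => //; exact: l_gt0.
  apply: (@le_trans _ _ (t * tau)); first by rewrite ler_pM2l.
  rewrite (_ : t * tau = d / 4); last by rewrite /t; field; rewrite !gt_eqF.
  lra.
set x := expR (- beta).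
have x0 : 0 <= x by exact: expR_ge0.
have n2 : 0 < 8 * n%:R ^+ 2 :> R by rewrite mulr_gt0 ?exprn_gt0.
have xn : x * (8 * n%:R ^+ 2) <= 1 by rewrite -ler_pdivlMr // div1r.
have kx : k%:R * x <= 2^-1 by nra.
have term_le j : P j ->
    2 * expR (2 * \sum_g X j g ^+ 2 - t * d * L j.2) <= 2 * expR (- beta * L j.2).
  move=> Pj; rewrite ler_pM2l // ler_expR.
  have -> : - beta = 2 * (t ^+ 2 * tau) - t * d.
    by rewrite betaE /t; field; rewrite !gt_eqF.
  rewrite mulrBl lerD2r -mulrA ler_pM2l // /L mulr_sumr [leRHS]big_mkcond /=.
  apply: ler_sum => g _; rewrite /X !inE.
  case: (boolP (g \in j.2)) => gU /=; last by rewrite expr0n.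
  have lg := lG _ _ (PG _ Pj) gU.
  case: ifP => [/andP[_ l_le]|_]; last first.
    by rewrite expr0n /=; apply/mulr_ge0/ltW => //; apply/mulr_ge0/ltW => //; exact: sqr_ge0.
  by rewrite exprMn -[leRHS]mulrA ler_pM2l ?exprn_gt0 // expr2 ler_pM2r.
(* At each threshold the nonempty supports contribute at most [(1 + x)^k - 1 <= 2 k x], the empty
   one accounting for the 1. Over [n] thresholds the total is at most
   [4 n k x <= 4 n^2 x <= 1/2]. *)
have total : \sum_(j | P j) 2 * expR (2 * \sum_g X j g ^+ 2 - t * d * L j.2) < 1.
  apply: le_lt_trans (ler_sum _ term_le) _.
  rewrite -(pair_big_dep (mem G) (fun h U => (U \in supp (T h) @: setT) && (U != set0))
    (fun h U => 2 * expR (- beta * L U))) /=.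
  apply: (@le_lt_trans _ _ (\sum_(h in G) 2 * (2 * (k%:R * x)))).
    apply: ler_sum => h hG; rewrite -mulr_sumr ler_pM2l //.
    apply: le_trans (pow1D_le x0 kx).
    rewrite lerBrDr; apply: le_trans (l_exp (l h / w h) beta).
    rewrite [leRHS](bigD1 set0) /=; last first.
      by apply/imsetP; exists 0; rewrite ?inE //; apply/esym/eqP/supp_eq0 => g _; rewrite dotb0.
    by rewrite big_set0 mulr0 expR0 addrC.
  rewrite sumr_const -mulr_natl -/n.
  have : n%:R * (k%:R * x) <= n%:R * (n%:R * x) by rewrite ler_pM2l // ler_wpM2r.
  nra.
have [s hs] := sign_choice X_le total.
have dev h a : h \in G ->
    `|\sum_(g in supp (T h) a) (if g \in S then (-1) ^+ s g * l g else 0)| <=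
    d * \sum_(g in supp (T h) a) l g.
  move=> hG; have [->|nz] := eqVneq (supp (T h) a) set0.
    by rewrite !big_set0 normr0 mulr0.
  have := hs (h, supp (T h) a); rewrite /P /= hG nz imset_f ?inE //= => /(_ isT).
  have -> : \sum_i (-1) ^+ s i * X (h, supp (T h) a) i =
     t * \sum_(g in supp (T h) a) (if g \in S then (-1) ^+ s g * l g else 0).
    rewrite mulr_sumr [RHS]big_mkcond; apply: eq_bigr => g _; rewrite /X in_setI /=.
    by case: (g \in supp (T h) a); case: (g \in S); rewrite /= ?mulr0 // mulrCA.
  by rewrite normrM gtr0_norm // -mulrA ler_pM2l.
(* Negating all signs preserves the deviations, so the kept generators of [S], those with [b g]
   false, can be made at most half of [S]. *)
have {hs} [b [card_b dev_b]] : exists b : {ffun F2vec k -> bool},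
    (2 * #|[set g in S | ~~ b g]| <= #|S|)%N /\ forall h a, h \in G ->
    `|\sum_(g in supp (T h) a) (if g \in S then (-1) ^+ b g * l g else 0)| <=
    d * \sum_(g in supp (T h) a) l g.
  have cardS : (#|[set g in S | ~~ s g]| + #|[set g in S | s g]| = #|S|)%N.
    rewrite -cardsUI (_ : _ :&: _ = set0); last first.
      by apply/setP => g; rewrite !inE; case: (s g); rewrite ?andbF.
    by rewrite cards0 addn0; apply: eq_card => g; rewrite !inE; case: (s g); rewrite ?andbF ?andbT ?orbF.
  case: (leqP (2 * #|[set g in S | ~~ s g]|) #|S|) => le_s; first by exists s.
  exists [ffun g => ~~ s g]; split.
    rewrite (eq_card (B := [set g in S | s g])) => [|g]; last by rewrite !inE ffunE negbK.
    by move: cardS le_s; clear; lia.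
  move=> h a hG; rewrite -normrN -sumrN; have := dev h a hG; congr (`|_| <= _).
  apply: eq_bigr => g _; rewrite ffunE; case: ifP; rewrite ?oppr0 //.
  by case: (s g); rewrite /= ?expr0 ?expr1 ?mulN1r ?mul1r ?opprK.
pose G' := [set g in G | (g \notin S) || ~~ b g].
pose w' g := if g \in S then 2 * w g else w g.
exists G', w'; split.
- by apply/subsetP => g; rewrite inE => /andP[].
- by move=> g; rewrite inE => /andP[/w_gt0 wg _]; rewrite /w'; case: ifP => _ //; rewrite mulr_gt0.
- have cG : (#|G :\: S| + #|S| = n)%N by rewrite /n -(cardsID S G) addnC (setIidPr SG).
  have cG' : #|G'| = (#|G :\: S| + #|[set g in S | ~~ b g]|)%N.
    rewrite -cardsUI (_ : _ :&: _ = set0) ?cards0 ?addn0; last first.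
      by apply/setP => g; rewrite !inE; case: (g \in G); case: (l g <= tau).
    apply: eq_card => g; rewrite !inE.
    by case: (g \in G); case: (l g <= tau); case: (b g).
  (* Since [#|G :\: S| <= n / 2] and at most half of [S] survives, at most [3 n / 4] generators
     remain. *)
  have : #|G :\: S|%:R * tau <= k%:R.
    apply: (@sumr_small_card _ _ _ l) => [g|].
      by rewrite !inE => /andP[+ gG]; rewrite gG /= -ltNge.
    rewrite -l_sum [leRHS](bigID (mem S)) /= ler_wpDl //.
      by apply: sumr_ge0 => g /andP[/l_gt0/ltW].
    by rewrite le_eqVlt; apply/orP; left; apply/eqP/eq_bigl => g; rewrite !inE andbC.
  rewrite /tau mulrA ler_pdivrMr // => le_kn2.
  have : (2 * #|G :\: S|)%N%:R <= n%:R :> R by rewrite natrM -(ler_pM2l k0); lra.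
  rewrite ler_nat.
  by rewrite cG'; move: card_b cG; clear; lia.
move=> a.
have cwE : cw w' G' a - cw w G a =
    \sum_(g in supp G a) w g / l g * (if g \in S then (-1) ^+ b g * l g else 0).
  rewrite /cw [X in X - _]big_mkcond [X in _ - X]big_mkcond [RHS]big_mkcond -sumrB /=.
  apply: eq_bigr => g _; rewrite !inE /w' inE.
  case: (boolP (g \in G)) => gG //=; last by rewrite subr0.
  case: (dotb a g); rewrite ?andbF ?subr0 //= ?andbT.
  have lg := l_gt0 g gG.
  case: (l g <= tau) => /=; last by rewrite subrr mulr0.
  case: (b g) => /=; field; rewrite gt_eqF //.
have cwl : cw w G a = \sum_(g in supp G a) w g / l g * l g.
  apply: eq_bigr => g; rewrite inE => /andP[gG _].
  by rewrite mulfVK // gt_eqF // l_gt0.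
(* The superlevel sets of [w g / l g] are the [T h], so inequalities on all the [T h] pass to the
   weighted sum by Abel summation. *)
have side (u : F2vec k -> R) :
    (forall h, h \in G -> 0 <= \sum_(g in supp (T h) a) u g) ->
    0 <= \sum_(g in supp G a) w g / l g * u g.
  move=> u_ge0; apply: layer_cake_ge0 => h; rewrite inE => /andP[hG ah].
    by rewrite divr_ge0 ?ltW ?l_gt0 ?w_gt0.
  have := u_ge0 h hG; congr (0 <= _); apply: eq_bigl => g; rewrite !inE.
  case: (boolP (g \in G)) => //= gG; rewrite andbC; congr (_ && _).
  rewrite -[w h / l h]invf_div -[w g / l g]invf_div lef_pV2 ?posrE ?divr_gt0 ?l_gt0 ?w_gt0 //.
rewrite ler_norml cwE cwl; apply/andP; split.
  rewrite -subr_ge0 opprK mulr_sumr -big_split /=.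
  rewrite (eq_bigr (fun g => w g / l g * ((if g \in S then (-1) ^+ b g * l g else 0) + d * l g))).
    apply: side => h hG; rewrite big_split -mulr_sumr /=.
    by have := dev_b h a hG; rewrite ler_norml => /andP[]; lra.
  by move=> g _; rewrite [RHS]mulrDr [in RHS]mulrCA.
rewrite -subr_ge0 mulr_sumr -sumrB.
rewrite (eq_bigr (fun g => w g / l g * (d * l g - (if g \in S then (-1) ^+ b g * l g else 0)))).
  apply: side => h hG; rewrite sumrB -mulr_sumr /=.
  by have := dev_b h a hG; rewrite ler_norml => /andP[]; lra.
by move=> g _; rewrite [RHS]mulrBr [in X in X - _]mulrCA.
Qed.

Lemma cw_ge0 (R : numDomainType) k (w : F2vec k -> R) (G : {set F2vec k}) a :
  {in G, forall g, 0 < w g} -> 0 <= cw w G a.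
Proof. by move=> w0; apply: sumr_ge0 => g; rewrite inE => /andP[/w0/ltW]. Qed.

Lemma cw_le0 (R : numDomainType) k (w : F2vec k -> R) (G : {set F2vec k}) a :
  {in G, forall g, 0 < w g} -> cw w G a <= 0 -> supp G a = set0.
Proof.
move=> w0; apply: contraTeq => /set0Pn[g gs].
have gG : g \in G by move: gs; rewrite inE => /andP[].
rewrite /cw (bigD1 g) //= lt_geF // ltr_wpDr ?w0 // sumr_ge0 // => h.
by rewrite inE => /andP[/andP[/w0/ltW]].
Qed.

(** Bernoulli bounds the exponent below by [M + 2 j M / 25], where [expR (2 M / 25) >= 2]. This
    beats [n^2 <= N^2 (16/9)^(j+1)] because [16/9 <= 2]; the leftover factor [8 * 16/9] is below
    16. *)
Lemma geometric_exponent (R : realType) (M N n : R) j :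
  25 / 2 <= M -> 16 * N ^+ 2 <= expR M -> 0 <= N -> 0 <= n ->
  n <= N * (4 / 3) ^+ j.+1 ->
  8 * n ^+ 2 <= expR (M * (27 / 25) ^+ j).
Proof.
move=> M_ge N_le N0 n0; rewrite exprS; set r := (4 / 3) ^+ j => n_le.
have r0 : 0 <= r by apply: exprn_ge0; clear; lra.
have bern : 1 + 2 / 25 * j%:R <= (27 / 25) ^+ j :> R.
  clear; elim: j => [|i IHi]; first by rewrite expr0 mulr0n mulr0 addr0.
  by rewrite exprS -natr1; have : 0 <= i%:R :> R by []; lra.
have M_gt0 : 0 < M by clear -M_ge; lra.
apply: le_trans (_ : expR (M * (1 + 2 / 25 * j%:R)) <= _); last first.
  by rewrite ler_expR ler_pM2l.
have -> : M * (1 + 2 / 25 * j%:R) = M + j%:R * (2 / 25 * M) by ring.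
rewrite expRD expRM_natl.
have e2 : 2 ^+ j <= expR (2 / 25 * M) ^+ j.
  apply: lerXn2r; rewrite ?nnegrE ?expR_ge0 //.
  by have := expR_ge1Dx (2 / 25 * M); clear -M_ge; lra.
apply: le_trans (ler_pM _ _ N_le e2); rewrite ?exprn_ge0 ?mulr_ge0 ?sqr_ge0 //.
have n_sq : n ^+ 2 <= 16 / 9 * (N ^+ 2 * r ^+ 2).
  have -> : 16 / 9 * (N ^+ 2 * r ^+ 2) = (N * (4 / 3 * r)) ^+ 2 by field.
  by apply: lerXn2r; rewrite ?nnegrE // !mulr_ge0 //; clear; lra.
have r2 : r ^+ 2 <= 2 ^+ j.
  rewrite /r exprAC; apply: lerXn2r; rewrite ?nnegrE ?sqr_ge0 ?ler0n //.
  by rewrite expr2; clear; lra.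
have : N ^+ 2 * r ^+ 2 <= N ^+ 2 * 2 ^+ j by rewrite ler_wpM2l ?sqr_ge0.
have : 0 <= N ^+ 2 * r ^+ 2 by rewrite mulr_ge0 ?sqr_ge0.
rewrite -(mulrA 16).
move: n_sq; move: (N ^+ 2 * r ^+ 2) (N ^+ 2 * 2 ^+ j) (n ^+ 2) => x y z; clear.
lra.
Qed.

(** The first error counts at most twice: directly, and through the second, whose factor
    [eps (1 - q)] is at most 1. Twice [eps q / 20] is exactly the gap between [eps (1 - 9 q / 10)]
    and [eps (1 - q)]. *)
Lemma error_step (R : realFieldType) (eps q c0 c1 c2 : R) :
  0 < eps < 1 -> 0 < q <= 1 -> 0 <= c0 ->
  `|c1 - c0| <= eps * q / 20 * c0 -> `|c2 - c1| <= eps * (1 - q) * c1 ->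
  `|c2 - c0| <= eps * (1 - 9 / 10 * q) * c0.
Proof.
move=> /andP[eps0 eps1] /andP[q0 q1] c0_ge0; rewrite !ler_norml.
move=> /andP[A1 A2] /andP[B1 B2].
have E0 : 0 <= eps * (1 - q) by rewrite mulr_ge0 ?subr_ge0 // ltW.
have E1 : eps * (1 - q) <= 1.
  by rewrite -[leRHS]mulr1 ler_pM ?subr_ge0 ?gerBl // ltW.
have D0 : 0 <= eps * q / 20 * c0 by apply/mulr_ge0 => //; apply: divr_ge0 => //; exact/ltW/mulr_gt0.
have : eps * (1 - q) * (eps * q / 20 * c0) <= eps * q / 20 * c0 by rewrite ler_piMl.
have : eps * (1 - q) * c1 <= eps * (1 - q) * c0 + eps * (1 - q) * (eps * q / 20 * c0).
  by rewrite -[leRHS]mulrDr ler_wpM2l //; clear -A2; lra.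
move: A1 A2 B1 B2.
have -> : eps * (1 - 9 / 10 * q) * c0 = eps * (1 - q) * c0 + 2 * (eps * q / 20 * c0).
  by field.
move: (eps * q / 20 * c0) (eps * (1 - q) * c1) (eps * (1 - q) * c0) => u v x.
move: (eps * (1 - q) * u) => y; clear => *; apply/andP; split; lra.
Qed.

(* The rounds have sizes at most [N (4/3)^j] and relative errors
   [eps (9/10)^j / 20]; since [(9/10)^2 * 4/3 > 1], the exponent available in
   round [j] grows geometrically, and so dominates the logarithm of the size. *)
Lemma sparsify_geometric (R : realType) k (N eps M : R) j :
  (0 < k)%N -> 0 < eps < 1 -> 0 < N ->
  eps ^+ 2 * N = 6400 * k%:R * M -> 25 / 2 <= M -> 16 * N ^+ 2 <= expR M ->
  forall (G : {set F2vec k}) (w : F2vec k -> R),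
  separating G -> 0 \notin G -> {in G, forall g, 0 < w g} ->
  #|G|%:R <= N * (4 / 3) ^+ j ->
  exists (G' : {set F2vec k}) (w' : F2vec k -> R),
  [/\ G' \subset G, {in G', forall g, 0 < w' g}, #|G'|%:R <= N &
      forall a, `|cw w' G' a - cw w G a| <= eps * (1 - (9 / 10) ^+ j) * cw w G a].
Proof.
move=> k_gt0 eps01 N_gt0 ME M_ge N_le; have /andP[eps_gt0 eps_lt1] := eps01.
have k0 : 0 < k%:R :> R by rewrite ltr0n.
have N_ge0 := ltW N_gt0.
elim: j => [|j IHj] G w sG G0 w0.
  rewrite expr0 mulr1 => G_le; exists G, w; split=> // a.
  by rewrite expr0 !subrr mulr0 mul0r normr0.
move=> G_le; rewrite exprS.
have q01 : 0 < (9 / 10 : R) ^+ j <= 1.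
  by apply/andP; split; [apply: exprn_gt0|apply: exprn_ile1]; clear; lra.
have /andP[q_gt0 q_le1] := q01; move: IHj.
set q := (9 / 10) ^+ j in q01 q_gt0 q_le1 * => IHj.
have [Gj_le|G_gt] := lerP (#|G|%:R) (N * (4 / 3) ^+ j).
  have [G' [w' [G'G w'0 G'N W]]] := IHj G w sG G0 w0 Gj_le.
  exists G', w'; split=> // a; apply: le_trans (W a) _.
  by rewrite ler_wpM2r ?cw_ge0 // ler_pM2l //; clear -q_gt0; lra.
have d01 : 0 < eps * q / 20 <= 1.
  have := mulr_gt0 eps_gt0 q_gt0.
  have := ler_pM (ltW eps_gt0) (ltW q_gt0) (ltW eps_lt1) q_le1.
  by rewrite mulr1; move: (eps * q) => x; clear => *; apply/andP; split; lra.
have hexp : expR (- ((eps * q / 20) ^+ 2 * #|G|%:R / (16 * k%:R))) <= (8 * #|G|%:R ^+ 2)^-1.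
  have n_gt0 : 0 < #|G|%:R :> R.
    by apply: le_lt_trans G_gt; rewrite mulr_ge0 // exprn_ge0 //; clear; lra.
  rewrite expRN lef_pV2 ?posrE ?expR_gt0 ?mulr_gt0 ?exprn_gt0 //.
  apply: le_trans (geometric_exponent M_ge N_le N_ge0 (ltW n_gt0) G_le) _.
  rewrite ler_expR.
  have qr : q ^+ 2 * (4 / 3) ^+ j = (27 / 25) ^+ j.
    by rewrite /q exprAC -exprMn; congr (_ ^+ _); clear; lra.
  (* The constant [6400 = 16 * 20^2] collects the denominators of the round error and of the rate in
     [sparsify_step]. *)
  have -> : M * (27 / 25) ^+ j = (eps * q / 20) ^+ 2 * (N * (4 / 3) ^+ j) / (16 * k%:R).
    have -> : (eps * q / 20) ^+ 2 * (N * (4 / 3) ^+ j) / (16 * k%:R) =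
      eps ^+ 2 * N * (q ^+ 2 * (4 / 3) ^+ j) / (6400 * k%:R).
      by move: ((4 / 3) ^+ j) => r; field; rewrite gt_eqF.
    by rewrite ME qr; field; rewrite gt_eqF.
  rewrite ler_pM2r ?invr_gt0 ?mulr_gt0 // ler_wpM2l ?sqr_ge0 // ltW //.
have [G1 [w1 [G1G w10 G1n W1]]] := sparsify_step k_gt0 sG G0 w0 d01 hexp.
have d_lt1 : 0 < 1 - eps * q / 20.
  have := ler_pM (ltW eps_gt0) (ltW q_gt0) (ltW eps_lt1) q_le1.
  by rewrite mulr1; move: (eps * q) => x; clear => *; lra.
(* A relative error below 1 cannot annihilate a nonzero codeword. *)
have sG1 : separating G1.
  apply/forallP => a; apply/implyP => /eqP suppa.
  have := W1 a; rewrite {1}/cw suppa big_set0 sub0r normrN ger0_norm ?cw_ge0 // => le_d.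
  apply: (implyP (forallP sG a)); apply/eqP; apply: (cw_le0 w0).
  by rewrite -(pmulr_rle0 _ d_lt1) mulrBl mul1r subr_le0.
have [|G2 [w2 [G2G1 w20 G2N W2]]] := IHj G1 w1 sG1 (contra (subsetP G1G 0) G0) w10.
  have : (4 * #|G1|)%N%:R <= (3 * #|G|)%N%:R :> R by rewrite ler_nat.
  move: G_le; rewrite !natrM exprS mulrCA.
  by move: (#|G1|%:R : R) (#|G|%:R : R) (N * _) => x y z; clear; lra.
exists G2, w2; split=> // [|a]; first exact: subset_trans G1G.
by apply: error_step (W1 a) (W2 a) => //; exact: cw_ge0.
Qed.

(** * Laplacians and codewords *)

Definition chi k (a x : F2vec k) : R := (-1) ^+ dotb a x.

Definition fourier k (f : F2vec k -> R) (a : F2vec k) : R := \sum_x f x * chi a x.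

Lemma chiD k (a x y : F2vec k) : chi a (x + y) = chi a x * chi a y.
Proof.
by rewrite /chi !(dotbC a) dotbD; case: (dotb x a); case: (dotb y a);
  rewrite /= ?expr0 ?expr1 ?mulr1 ?mul1r ?mulrN1 ?opprK.
Qed.

(** Orthogonality of characters: for nonzero [z], translating [a] by some [e] with [dotb e z]
    negates the sum. *)
Lemma chi_sum k (z : F2vec k) :
  \sum_a chi a z = if z == 0 then #|{: F2vec k}|%:R else 0.
Proof.
case: eqVneq => [->|/dotb_nondeg[e ez]].
  rewrite (eq_bigr (fun _ => 1)) ?sumr_const // => a _.
  by rewrite /chi dotbC dotb0.
suff : \sum_a chi a z = - \sum_a chi a z by lra.
rewrite [LHS](reindex (fun a => a + e)) /=; last first.
  by apply: onW_bij; exists (fun a => a - e) => a; rewrite ?addrK ?subrK.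
rewrite -sumrN; apply: eq_bigr => a _; rewrite /chi dotbD ez addbT.
by case: (dotb a z); rewrite /= ?expr0 ?expr1 ?opprK.
Qed.

(** Wiener-Khinchin identity: after expanding the square, orthogonality keeps only [y = x + g]. *)
Lemma fourier_shift k (f : F2vec k -> R) (g : F2vec k) :
  \sum_a fourier f a ^+ 2 * chi a g = #|{: F2vec k}|%:R * \sum_x f x * f (x + g).
Proof.
transitivity (\sum_x \sum_y f x * f y * \sum_a chi a (x + y + g)).
  transitivity (\sum_a \sum_x \sum_y f x * f y * chi a (x + y + g)).
    apply: eq_bigr => a _; rewrite expr2 /fourier !mulr_suml; apply: eq_bigr => x _.
    rewrite mulr_sumr mulr_suml; apply: eq_bigr => y _.
    by rewrite !chiD; ring.
  rewrite exchange_big /=; apply: eq_bigr => x _.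
  by rewrite exchange_big /=; apply: eq_bigr => y _; rewrite mulr_sumr.
rewrite mulr_sumr; apply: eq_bigr => x _.
rewrite (bigD1 (x + g)) //= [X in _ + X]big1 => [|y ny]; rewrite chi_sum.
  by rewrite addrA addvv add0r addvv eqxx addr0 mulrC.
case: eqP => [E|]; rewrite ?mulr0 //.
have E' : y + (x + g) = 0 by rewrite addrCA addrA.
by case/eqP: ny; rewrite -[LHS]addr0 -(addvv (x + g)) addrA E' add0r.
Qed.

Lemma cay_lap_form k (G : {set F2vec k}) (w f : F2vec k -> R) :
  \sum_x \sum_y f x * cay_lap G w x y * f y =
  \sum_(g in G) w g * \sum_x (f x ^+ 2 - f x * f (x + g)).
Proof.
under [RHS]eq_bigr do rewrite mulr_sumr.
rewrite [RHS]exchange_big /=; apply: eq_bigr => x _.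
have inner (h : F2vec k -> R) :
    \sum_y cay_adj G w x y * h y = \sum_(g in G) w g * h (x + g).
  under eq_bigr do rewrite /cay_adj big_mkcondr mulr_suml.
  rewrite exchange_big /=; apply: eq_bigr => g _.
  rewrite (bigD1 (x + g)) //= eqxx big1 ?addr0 // => y.
  by rewrite eq_sym => /negbTE ->; rewrite mul0r.
have deg : cay_deg G w x = \sum_(g in G) w g.
  rewrite /cay_deg; under eq_bigr do rewrite -[cay_adj _ _ _ _]mulr1.
  by rewrite inner; apply: eq_bigr => g _; rewrite mulr1.
under eq_bigr do rewrite /cay_lap mulrBr mulrBl -mulrA -[f x * _ * f _]mulrA.
rewrite sumrB -!mulr_sumr inner (bigD1 x) //= eqxx big1 => [|y]; last first.
  by rewrite eq_sym => /negbTE ->; rewrite mul0r.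
rewrite addr0 deg mulr_suml -mulrBr -sumrB mulr_sumr.
by apply: eq_bigr => g _; ring.
Qed.

(** Apply [fourier_shift] at [g] and at 0: [1 - chi a g] is 2 when [dotb a g] and 0 otherwise. *)
Lemma cay_lap_spectral k (G : {set F2vec k}) (w f : F2vec k -> R) :
  #|{: F2vec k}|%:R * (\sum_x \sum_y f x * cay_lap G w x y * f y) =
  \sum_a fourier f a ^+ 2 * (2 * cw w G a).
Proof.
rewrite cay_lap_form mulr_sumr.
transitivity (\sum_(g in G) w g * \sum_a fourier f a ^+ 2 * (1 - chi a g)).
  apply: eq_bigr => g _; rewrite mulrCA; congr (_ * _).
  rewrite sumrB mulrBr -fourier_shift.
  have -> : \sum_x f x ^+ 2 = \sum_x f x * f (x + 0).
    by apply: eq_bigr => x _; rewrite addr0.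
  rewrite -fourier_shift -sumrB; apply: eq_bigr => a _.
  by rewrite mulrBr /chi [dotb a 0]dotbC dotb0 expr0.
under eq_bigr do rewrite mulr_sumr.
rewrite exchange_big /=; apply: eq_bigr => a _.
rewrite /cw !mulr_sumr [RHS]big_mkcond [LHS]big_mkcond /=.
apply: eq_bigr => g _; rewrite inE /chi; case: (g \in G) => //=.
by case: (dotb a g); rewrite /= ?expr0 ?expr1; ring.
Qed.

(** The Laplacians share the characters as eigenvectors, so eigenvalues can be compared one by
    one. *)
Lemma loewner_cw k (G1 G2 : {set F2vec k}) (w1 w2 : F2vec k -> R) (s t : R) :
  (forall a, s * cw w1 G1 a <= t * cw w2 G2 a) ->
  loewner_le (scale_mx s (cay_lap G1 w1)) (scale_mx t (cay_lap G2 w2)).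
Proof.
move=> le_cw f.
have c_gt0 : (0 : R) < #|{: F2vec k}|%:R by rewrite card_F2vec ltr0n expn_gt0.
rewrite -(pmulr_rge0 _ c_gt0).
have -> : \sum_x \sum_y f x * (scale_mx t (cay_lap G2 w2) x y -
      scale_mx s (cay_lap G1 w1) x y) * f y =
    t * (\sum_x \sum_y f x * cay_lap G2 w2 x y * f y) -
    s * (\sum_x \sum_y f x * cay_lap G1 w1 x y * f y).
  rewrite !mulr_sumr -sumrB; apply: eq_bigr => x _.
  rewrite !mulr_sumr -sumrB; apply: eq_bigr => y _.
  by rewrite /scale_mx; ring.
rewrite mulrBr mulrCA [X in _ - X]mulrCA !cay_lap_spectral !mulr_sumr -sumrB.
apply: sumr_ge0 => a _.
have -> : t * (fourier f a ^+ 2 * (2 * cw w2 G2 a)) - s * (fourier f a ^+ 2 * (2 * cw w1 G1 a)) =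
  fourier f a ^+ 2 * (2 * (t * cw w2 G2 a - s * cw w1 G1 a)) by ring.
by rewrite mulr_ge0 ?sqr_ge0 // mulr_ge0 // subr_ge0.
Qed.

Lemma generates_separating k (G : {set F2vec k}) : generates G -> separating G.
Proof.
move=> gG; apply/forallP => a; apply/implyP => /supp_eq0 aG.
apply: contraT => /dotb_nondeg[x]; have [S [SG ->]] := gG x.
rewrite dotb_sum big1 // => g gS; rewrite dotbC.
by apply/negbTE/aG/(subsetP SG).
Qed.

(** A zero generator gives only loops, invisible to the Laplacian, so it can be discarded before
    sparsifying. *)
Lemma suppD1_0 k (G : {set F2vec k}) a : supp (G :\ 0) a = supp G a.
Proof.
apply/setP => g; rewrite !inE; case: eqP => //= ->.
by rewrite dotbC dotb0 andbF.
Qed.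

(** * Logarithmic estimates and the choice of constants *)

Lemma ln_over_ln2_ge (R : realType) (z : R) :
  4 <= z -> 2 <= ln z / ln 2 /\ z <= expR (ln z / ln 2).
Proof.
move=> z4.
have z0 : 0 < z by lra.
have ln2_gt0 : 0 < ln (2 : R) by apply: ln_gt0; lra.
have ln2_le1 : ln (2 : R) <= 1.
  rewrite -ler_expR lnK ?posrE //; have := expR_ge1Dx (1 : R); lra.
have lnz : 2 * ln 2 <= ln z.
  have -> : 2 * ln 2 = ln (2 * 2) :> R by rewrite lnM ?posrE // mulr2n mulrDl !mul1r.
  by rewrite ler_ln ?posrE //; lra.
split; first by rewrite ler_pdivlMr.
rewrite -[leLHS](lnK (_ : z \is Num.pos)) ?posrE // ler_expR ler_pdivlMr //.
by rewrite ler_piMr // (le_trans _ lnz) // mulr_ge0 // ltW.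
Qed.

Lemma log2_ge (z : R) : 4 <= z -> 2 <= log2 z /\ z <= expR (log2 z).
Proof. by rewrite /log2 RdivE !RlnE; exact: ln_over_ln2_ge. Qed.

(** With [e = expR Y >= 3], the bounds [40 <= e^4] and [Y, z <= e] give [N <= e^15], hence
    [16 N^2 <= e^34 <= e^40]. *)
Lemma sixteen_sqr_le_expR (R : realType) (Y N z : R) :
  2 <= Y -> 0 <= z -> z <= expR Y -> 0 <= N -> N <= 40 ^+ 3 * Y * z ^+ 2 ->
  16 * N ^+ 2 <= expR (40 * Y).
Proof.
move=> Y2 z0 z_le N0 N_le; rewrite expRM_natl.
have := expR_ge1Dx Y; move: (expR Y) z_le => e z_le Ye.
have e3 : 3 <= e by clear -Y2 Ye; lra.
have Y_le : Y <= e by clear -Ye; lra.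
have Y0 : 0 <= Y by clear -Y2; lra.
have e0 : 0 <= e by clear -e3; lra.
have e81 : 3 ^+ 4 <= e ^+ 4 by apply: lerXn2r; rewrite ?nnegrE.
have e40 : 40 <= e ^+ 4 by apply: le_trans e81; clear; lra.
have e16 : 16 <= e ^+ 4 by apply: le_trans e40; clear; lra.
have Ne : N <= e ^+ 15.
  apply: le_trans N_le _; rewrite (exprD e 12 3) (exprM e 4 3) (exprS e 2) -mulrA.
  apply: ler_pM; rewrite ?mulr_ge0 ?sqr_ge0 ?exprn_ge0 //.
    by apply: lerXn2r; rewrite ?nnegrE ?exprn_ge0.
  by apply: ler_pM; rewrite ?sqr_ge0 //; apply: lerXn2r; rewrite ?nnegrE.
have N2 : N ^+ 2 <= (e ^+ 15) ^+ 2 by apply: lerXn2r; rewrite ?nnegrE ?exprn_ge0.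
apply: le_trans (ler_pM _ _ e16 N2) _; rewrite ?sqr_ge0 //.
by rewrite -exprM -exprD ler_eXn2l //; clear -e3; lra.
Qed.

Theorem theorem1p4 :
  exists C c : R, 0 < C /\ 0 < c /\
  forall (k : nat) (eps : R), leq 1 k -> 0 < eps < 1 ->
  forall (Gamma : {set F2vec k}) (w : F2vec k -> R),
    generates Gamma -> (forall g, g \in Gamma -> 0 < w g) ->
  exists (Gammah : {set F2vec k}) (wh : F2vec k -> R),
    [/\ Gammah \subset Gamma,
        (forall g, g \in Gammah -> 0 < wh g),
        #|Gammah|%:R <= C * (k%:R / eps ^+ 2) * Rpower (log2 (4 * k%:R / eps)) c,
        loewner_le (scale_mx (1 - eps) (cay_lap Gamma w)) (cay_lap Gammah wh)
      & loewner_le (cay_lap Gammah wh) (scale_mx (1 + eps) (cay_lap Gamma w))].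
Proof.
(* The logarithm [Y] enters to the first power; the constant comes from [N = 6400 k M / eps^2] with
   [M = 40 Y]. *)
exists (40 * 6400), 1; split; first lra; split; first lra.
move=> k eps k_gt0 eps01 G w genG w_gt0; have /andP[eps_gt0 eps_lt1] := eps01.
have k1 : 1 <= k%:R :> R by rewrite ler1n.
pose z := 4 * k%:R / eps.
(* The argument of [log2] in the statement is written in the scope of Stdlib's
   reals, with the integer literal [4%Z]. *)
have -> : Rdiv (Rmult (IZR 4) k%:R) eps = z by rewrite RdivE RmultE IZRposE INRE.
have z4 : 4 <= z by rewrite /z ler_pdivlMr //; nra.
have [Y2 zY] := log2_ge z4.
set Y := log2 z in Y2 zY *.
have Y_gt0 : 0 < Y by clear -Y2; lra.
rewrite Rpower_1; last exact/RltP.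
set N := (40 * 6400) * (k%:R / eps ^+ 2) * Y.
have N_gt0 : 0 < N.
  by rewrite /N; apply/mulr_gt0/Y_gt0/mulr_gt0/divr_gt0/exprn_gt0 => //; lra.
have ME : eps ^+ 2 * N = 6400 * k%:R * (40 * Y).
  by rewrite /N; field; rewrite gt_eqF.
have N_le : N <= 40 ^+ 3 * Y * z ^+ 2.
  have -> : 40 ^+ 3 * Y * z ^+ 2 = N * (4 * k%:R).
    by rewrite /N /z; field; rewrite gt_eqF.
  by rewrite ler_peMr ?(ltW N_gt0) //; clear -k1; lra.
(* Any number of rounds will do, since the final size bound is [N] and the error stays below [eps].
   As [(4/3)^3 >= 2], three rounds per generator are enough. *)
have [j Gj] : exists j, #|G :\ 0|%:R <= N * (4 / 3) ^+ j.
  have N1 : 1 <= N.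
    have : 1 <= k%:R / eps ^+ 2 by rewrite ler_pdivlMr ?exprn_gt0 //; nra.
    by rewrite /N; move: (k%:R / eps ^+ 2) => y; nra.
  exists (3 * #|G :\ 0%R|)%N; move: #|G :\ 0| => n.
  have bern : n%:R <= (4 / 3) ^+ (3 * n) :> R.
    elim: n => [|n IHn]; first by rewrite muln0 expr0 mulr0n.
    rewrite mulnS exprD -natr1 !exprS expr0.
    have : 0 <= n%:R :> R by exact: ler0n.
    have : 1 <= (4 / 3) ^+ (3 * n) :> R by apply: exprn_ege1; lra.
    lra.
  by apply: le_trans bern _; rewrite ler_peMl // exprn_ge0 //; lra.
have sG : separating (G :\ 0).
  by have := generates_separating genG; congr is_true; apply: eq_forallb => a; rewrite suppD1_0.
have [|||H [wh [HG wh_gt0 H_le HW]]] := @sparsify_geometric R k N eps _ j k_gt0 eps01 N_gt0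
  ME _ _ (G :\ 0) w sG (negbT (setD11 _ _)) _ Gj.
- by clear -Y2; lra.
- apply: (sixteen_sqr_le_expR Y2 _ zY _ N_le); [clear -z4; lra|exact: ltW].
- by move=> g /setD1P[_ /w_gt0].
have W a : (1 - eps) * cw w G a <= cw wh H a <= (1 + eps) * cw w G a.
  have c_ge0 : 0 <= cw w G a by exact: cw_ge0.
  have := HW a; rewrite /cw suppD1_0 -/(cw w G a) -/(cw wh H a) => Wa.
  have {Wa} : `|cw wh H a - cw w G a| <= eps * cw w G a.
    apply: le_trans Wa _; apply: ler_wpM2r => //; apply: ler_piMr; first exact: ltW.
    by rewrite gerBl exprn_ge0 //; clear; lra.
  by rewrite ler_norml => /andP[lo hi]; apply/andP; split; clear -lo hi; lra.
have one_lap (X : {set F2vec k}) v : scale_mx 1 (cay_lap X v) = cay_lap X v.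
  by apply/funext => x; apply/funext => y; rewrite /scale_mx mul1r.
exists H, wh; split=> //.
- exact: subset_trans HG (subD1set _ _).
- rewrite -[cay_lap H wh]one_lap; apply: loewner_cw => a.
  by rewrite mul1r; case/andP: (W a).
rewrite -[cay_lap H wh]one_lap; apply: loewner_cw => a.
by rewrite mul1r; case/andP: (W a).
Qed.
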